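(* Let $H$ and $K$ be incompatible groups. If $H$ or $K$ satisfies the minimal condition on normal subgroups, then $\mathcal{A}_{H,K}$ is a subgroup of $\operatorname{Aut}(H\times K)$. If both $H$ and $K$ satisfy the minimal condition on normal subgroups, then $\operatorname{Aut}(H\times K)\simeq\mathcal{A}_{H,K}$.
   Context: An endomorphism $\varphi$ of $H\times K$ is identified with the matrix $\begin{pmatrix}\alpha&\beta\\ \gamma&\delta\end{pmatrix}$, where $\alpha\in\operatorname{End}H$, $\beta\in\operatorname{Hom}(K,H)$, $\gamma\in\operatorname{Hom}(H,K)$, $\delta\in\operatorname{End}K$ and $\varphi(h,k)=(\alpha(h)\beta(k),\gamma(h)\delta(k))$; composition corresponds to row-by-column multiplication, with $(f+g)(x)=f(x)g(x)$. The set $\mathcal{A}_{H,K}$ consists of all such matrices with $\alpha\in\operatorname{Aut}H$, $\delta\in\operatorname{Aut}K$, $\beta\in\operatorname{Hom}(K,Z(H))$, $\gamma\in\operatorname{Hom}(H,Z(K))$. Statements relating $\mathcal{A}_{H,K}$ and $\operatorname{Aut}(H\times K)$ refer to this identification; $\operatorname{Aut}(H\times K)\simeq\mathcal{A}_{H,K}$ means that the set of automorphisms of $H\times K$ is exactly $\mathcal{A}_{H,K}$. An endomorphism of a group is normal if it commutes with every inner automorphism. $H$ and $K$ are incompatible if for all $\sigma\in\operatorname{Hom}(H,K)$ and $\tau\in\operatorname{Hom}(K,H)$ such that $\sigma\tau$ and $\tau\sigma$ are normal, the only $k\in K$ with $\sigma\tau(k)=k$ is $k=1$ (equivalently, the only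 $h\in H$ with $\tau\sigma(h)=h$ is $h=1$). *)

(* Defs.v *)
From HB Require Import structures.
From mathcomp Require Import all_boot.
From mathcomp Require Import boolp classical_sets.

Set Implicit Arguments.
Unset Strict Implicit.
Unset Printing Implicit Defensive.

Local Open Scope classical_set_scope.
Local Open Scope group_scope.

(* Groups are possibly infinite: groupType is the MathComp structure of all   *)
(* groups, and subsets of a group are Prop-valued.                            *)

Notation hom := UMagmaMorphism.type.

Definition center (G : groupType) : set G :=
  [set z | forall x : G, commute z x].
Arguments center : clear implicits.

Definition is_subgroup (G : groupType) (A : set G) : Prop :=
  [/\ A 1, forall x y, A x -> A y -> A (x * y) & forall x, A x -> A x^-1].

Definition is_normal_subgroup (G : groupType) (N : set G) : Prop :=
  is_subgroup N /\ forall x g, N x -> N (x ^ g).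

Definition min_normal (G : groupType) : Prop :=
  forall F : set (set G), F !=set0 -> F `<=` @is_normal_subgroup G ->
  exists2 N, F N & forall M, F M -> M `<=` N -> M = N.

Definition inner_aut (G : groupType) (g : G) : G -> G := fun x => x ^ g.

Definition normal_endo (G : groupType) (f : G -> G) : Prop :=
  forall g : G, f \o inner_aut g =1 inner_aut g \o f.

Definition incompatible (H K : groupType) : Prop :=
  forall (sigma : hom H K) (tau : hom K H),
    normal_endo (sigma \o tau) -> normal_endo (tau \o sigma) ->
  forall k : K, sigma (tau k) = k -> k = 1.

Definition Aut (G : groupType) : set (G -> G) :=
  [set f | monoid_morphism f /\ bijective f].
Arguments Aut : clear implicits.

Definition subgroup_of_Aut (G : groupType) (S : set (G -> G)) : Prop :=
  [/\ S `<=` Aut G,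
      S idfun,
      forall f g, S f -> S g -> S (f \o g)
    & forall f g, S f -> cancel f g -> cancel g f -> S g].

Record endo_matrix (H K : groupType) := EndoMatrix {
  mx_alpha : hom H H;
  mx_beta  : hom K H;
  mx_gamma : hom H K;
  mx_delta : hom K K
}.

(* In general this map is an endomorphism only if alpha and beta, and gamma   *)
(* and delta, have commuting images; this holds on calA below, where beta and *)
(* gamma are central.                                                         *)
Definition endo_of_matrix (H K : groupType) (M : endo_matrix H K) :
    H * K -> H * K :=
  fun x => (mx_alpha M x.1 * mx_beta M x.2, mx_gamma M x.1 * mx_delta M x.2).

Definition calA_matrix (H K : groupType) : set (endo_matrix H K) :=
  [set M | [/\ Aut H (mx_alpha M), Aut K (mx_delta M),
               forall k, center H (mx_beta M k)
             & forall h, center K (mx_gamma M h)]].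
Arguments calA_matrix : clear implicits.

(* The matrices of calA_matrix, identified with self-maps of H * K. *)
Definition calA (H K : groupType) : set (H * K -> H * K) :=
  @endo_of_matrix H K @` calA_matrix H K.
Arguments calA : clear implicits.

(* Main.v *)
(* If beta and gamma are central, then beta gamma is a normal endomorphism,   *)
(* so incompatibility makes 1 + beta gamma injective. An injective normal     *)
(* endomorphism f of a group with the minimal condition on normal subgroups   *)
(* is surjective, because the normal subgroups f^n(G) stabilize; and          *)
(* 1 + beta gamma is surjective as soon as 1 + gamma beta is, so it suffices  *)
(* that one of the two groups satisfies the condition. That the matrices with *)
(* central off-diagonal entries form a subgroup of the automorphism group     *)
(* reduces to the bijectivity of such maps.                                   *)
(*   For an arbitrary automorphism phi with inverse psi, primes denoting the  *)
(* entries of psi, beta' gamma and gamma beta' are restrictions of conjugates *)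
(* of the projections of H * K, hence normal. Incompatibility then makes      *)
(* alpha' alpha = 1 - beta' gamma injective, hence bijective; exchanging phi  *)
(* and psi, alpha is bijective, and so is delta. The images of alpha and beta *)
(* commute, so beta is central once alpha is onto; similarly for gamma.       *)
Require Import Defs.
From HB Require Import structures.
From mathcomp Require Import all_boot.
From mathcomp Require Import boolp classical_sets.

Set Implicit Arguments.
Unset Strict Implicit.
Unset Printing Implicit Defensive.

Local Open Scope classical_set_scope.
Local Open Scope group_scope.

(** Write sums for pointwise products. The key fact is [add_central_bij]: a + bc is bijective when a
    is an automorphism and b, c are central, because it factors as a (1 + a^-1 b c). Applied to a
    Schur complement it makes the matrices of [calA_matrix] bijective ([calA_bij]); applied to
    diagonal entries it gives closure under products and inverses ([calA_comp], [calA_inverse]). For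
    the converse, [Aut_calA_matrix] compares an automorphism with its inverse: the kernel of alpha'
    alpha is fixed by the normal endomorphism beta' gamma, hence trivial, and the minimal condition
    on each factor makes the diagonal entries bijective. *)

Lemma inj_surj_bij (A B : Type) (f : A -> B) :
  injective f -> (forall y, exists x, f x = y) -> bijective f.
Proof.
move=> f_inj f_surj; have [g gK] := choice f_surj.
by exists g => // x; apply: f_inj; rewrite gK.
Qed.

Lemma bij_surj (A B : Type) (f : A -> B) (y : B) :
  bijective f -> exists x, f x = y.
Proof. by case=> g _ gK; exists (g y). Qed.

Lemma comp_bij_bij (A : Type) (u v : A -> A) :
  bijective (u \o v) -> bijective (v \o u) -> bijective u.
Proof.
move=> uv_bij vu_bij; apply: inj_surj_bij => [x y xy|y].
  by apply: (bij_inj vu_bij); rewrite /= xy.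
by have [x <-] := bij_surj y uv_bij; exists (v x).
Qed.

Lemma hom_morphism (G H : groupType) (f : hom G H) : monoid_morphism f.
Proof. by split; [exact: gmulf1 | exact: gmulfM]. Qed.

Lemma morphism_hom (G H : groupType) (f : G -> H) :
  monoid_morphism f -> exists F : hom G H, F = f :> (G -> H).
Proof.
move=> fM.
pose F : hom G H := HB.pack f (@isUMagmaMorphism.Build G H f fM).
by exists F.
Qed.

Lemma Aut_inverse (G : groupType) (f g : G -> G) :
  Aut G f -> cancel f g -> cancel g f -> Aut G g.
Proof.
move=> [/morphism_hom[F <-] _] fK gK; split; last by exists F.
by split; [exact: can2_gmulf1 fK gK | exact: can2_gmulfM fK gK].
Qed.

Lemma Aut_hom_inverse (G : groupType) (f : G -> G) :
  Aut G f -> exists2 g : hom G G, cancel f g & cancel g f.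
Proof.
move=> fA; have [_ [g fK gK]] := fA.
by have [/morphism_hom[F Fg] _] := Aut_inverse fA fK gK; exists F; rewrite Fg.
Qed.

(** * Central elements and homomorphisms with central image *)

Section Center.
Variable G : groupType.

Lemma centerM (x y : G) : center G x -> center G y -> center G (x * y).
Proof.
move=> xZ yZ z; apply: commute_sym.
apply: commuteM; apply: commute_sym; [exact: xZ | exact: yZ].
Qed.

Lemma centerV (x : G) : center G x -> center G x^-1.
Proof.
by move=> xZ z; apply: commute_sym; apply: commuteV; apply: commute_sym.
Qed.

Lemma center_conj (x g : G) : center G x -> x ^ g = x.
Proof. by move=> xZ; rewrite conjgE xZ mulKg. Qed.

Lemma center_surj (H : groupType) (f : hom G H) (x : G) :
  (forall y, exists x, f x = y) -> center G x -> center H (f x).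
Proof. by move=> fS xZ y; have [z <-] := fS y; apply/gmulf_commute/xZ. Qed.

End Center.

Lemma central_hom_inv (G H : groupType) (f : hom G H) :
    (forall x, center H (f x)) ->
  exists f' : hom G H, forall x, f' x = (f x)^-1.
Proof.
move=> fZ; have fVM : monoid_morphism (fun x => (f x)^-1).
  split=> [|x y]; first by rewrite gmulf1 invg1.
  by rewrite gmulfM invgM; exact: (centerV (fZ y)).
by have [f' f'E] := morphism_hom fVM; exists f' => x; rewrite f'E.
Qed.

(** Conjugating a central element does nothing, so both sides equal [b (c x)]. *)
Lemma central_normal (H K : groupType) (b : hom K H) (c : hom H K) :
  (forall k, center H (b k)) -> normal_endo (b \o c).
Proof. by move=> bZ g x; rewrite /= /inner_aut !gmulfJ !center_conj. Qed.

(** * Normal endomorphisms, the minimal condition and incompatibility *)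

Lemma normal_range_iter (G : groupType) (f : hom G G) n :
  normal_endo f -> is_normal_subgroup (range (iter n f)).
Proof.
move=> fN; have iterM : monoid_morphism (iter n f).
  elim: n => [|n [IH1 IHM]] //=; split=> [|x y] /=; first by rewrite IH1 gmulf1.
  by rewrite IHM gmulfM.
have iterJ x g : iter n f (x ^ g) = iter n f x ^ g.
  by elim: n {iterM} => //= n ->; exact: fN.
have [F FE] := morphism_hom iterM; rewrite -FE in iterJ *.
split=> [|_ g [x _ <-]]; last by exists (x ^ g).
split=> [|_ _ [x _ <-] [y _ <-]|_ [x _ <-]].
- by exists 1; rewrite ?gmulf1.
- by exists (x * y); rewrite ?gmulfM.
- by exists x^-1; rewrite ?gmulfV.
Qed.

Lemma min_normal_surj (G : groupType) (f : hom G G) :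
    min_normal G -> normal_endo f -> injective f ->
  forall y, exists x, f x = y.
Proof.
move=> minG fN f_inj y.
have [|_ [n _ <-]|_ [n _ <-] nmin] :=
  minG (range (fun n => range (iter n f))).
- by exists (range (iter 0 f)), 0.
- exact: normal_range_iter.
have : range (iter n.+1 f) = range (iter n f).
  apply: nmin; first by exists n.+1.
  by move=> _ [x _ <-]; exists (f x); rewrite // -iterSr.
(* The ranges have stabilized, so f^n(y) = f^n(f(x)) for some x; injectivity cancels the n outer
   applications. *)
move=> /seteqP[_ /(_ (iter n f y))] [|x _ xy]; first by exists y.
exists x; move: xy; rewrite iterSr.
by elim: n {nmin} => //= n IH /f_inj; exact: IH.
Qed.

(** If [s (t h) = h], then [t h] is fixed by [t \o s], hence trivial, and so is [h]. *)
Lemma incompatible_sym (H K : groupType) :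
  incompatible H K -> incompatible K H.
Proof.
move=> inc s t stN tsN h sth.
have th1 : t h = 1 by apply: (inc t s tsN stN); rewrite sth.
by rewrite -sth th1 gmulf1.
Qed.

(** * Bijectivity of central perturbations of automorphisms *)

Section CentralPerturbation.
Variables (H K : groupType) (b : hom K H) (c : hom H K).
Hypotheses (bZ : forall k, center H (b k)) (cZ : forall h, center K (c h)).

Lemma add_central_morphism : monoid_morphism (fun h => h * b (c h)).
Proof.
split=> [|x y]; first by rewrite !gmulf1 mulg1.
by rewrite !gmulfM -!mulgA; congr (_ * _); rewrite !mulgA bZ.
Qed.

(** An element of the kernel of 1 + bc is a fixed point of (-b)c, where -b is again a central
    homomorphism. *)
Lemma add_central_inj : incompatible H K -> injective (fun h => h * b (c h)).
Proof.
move=> inc; have [f fE] := morphism_hom add_central_morphism.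
rewrite -fE; apply: gmulf_inj => x; rewrite fE => x1.
have [b' b'E] := central_hom_inv bZ.
have b'Z k : center H (b' k) by rewrite b'E; apply: centerV.
apply: (@incompatible_sym H K inc b' c).
- exact: central_normal.
- exact: central_normal.
by rewrite b'E -(mulg1_eq x1) invgK.
Qed.

Lemma add_central_surj : min_normal H -> incompatible H K ->
  forall y, exists x, x * b (c x) = y.
Proof.
move=> minH inc; have [f fE] := morphism_hom add_central_morphism.
suff: forall y, exists x, f x = y by rewrite fE.
apply: min_normal_surj => //; last by rewrite fE; exact: add_central_inj.
move=> g x; rewrite /= fE /inner_aut conjMg; congr (_ * _).
exact: (central_normal c bZ g x).
Qed.

(* (1 + b c)^-1 = 1 - b (1 + c b)^-1 c *)
Lemma add_central_surj_swap :
    (forall k, exists k', k' * c (b k') = k) ->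
  forall h, exists h', h' * b (c h') = h.
Proof.
move=> cbS h; have [k kE] := cbS (c h).
exists (h * b k^-1).
rewrite -mulgA -gmulfM [c (_ * _)]gmulfM -kE !gmulfV mulgK mulVg.
by rewrite gmulf1 mulg1.
Qed.

End CentralPerturbation.

Lemma add_central_bij (H K : groupType) (a : hom H H) (b : hom K H)
    (c : hom H K) :
    incompatible H K -> min_normal H \/ min_normal K -> bijective a ->
    (forall k, center H (b k)) -> (forall h, center K (c h)) ->
  bijective (fun h => a h * b (c h)).
Proof.
move=> inc minHK a_bij bZ cZ.
have [a' aK a'K] := Aut_hom_inverse (conj (hom_morphism a) a_bij).
(* Factor out [a]; its inverse preserves the center, so [b'] is still central. *)
pose b' : hom K H := a' \o b.
have b'Z k : center H (b' k).
  by apply: (center_surj (f := a')) => // y; exists (a y).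
have b'c_bij : bijective (fun h => h * b' (c h)).
  apply: inj_surj_bij; first exact: add_central_inj.
  case: minHK => [minH|minK]; first exact: add_central_surj.
  apply: add_central_surj_swap; apply: add_central_surj => //.
  exact: incompatible_sym.
by apply: (eq_bij (bij_comp a_bij b'c_bij)) => h /=; rewrite gmulfM a'K.
Qed.

(** * Endomorphisms of the product and their matrices *)

Definition pair_inl (H K : groupType) (h : H) : H * K := (h, 1).
Definition pair_inr (H K : groupType) (k : K) : H * K := (1, k).

Lemma pair_inl_morphism (H K : groupType) : monoid_morphism (@pair_inl H K).
Proof. by split=> // x y; congr (_, _); rewrite mulg1. Qed.

Lemma pair_inr_morphism (H K : groupType) : monoid_morphism (@pair_inr H K).
Proof. by split=> // x y; congr (_, _); rewrite mulg1. Qed.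

HB.instance Definition _ (H K : groupType) :=
  isUMagmaMorphism.Build H (H * K)%type (@pair_inl H K)
    (@pair_inl_morphism H K).
#[warning="-redundant-canonical-projection"]
HB.instance Definition _ (H K : groupType) :=
  isUMagmaMorphism.Build K (H * K)%type (@pair_inr H K)
    (@pair_inr_morphism H K).

Definition matrix_of (H K : groupType) (f : hom (H * K)%type (H * K)%type) :
    endo_matrix H K :=
  EndoMatrix (fst \o f \o @pair_inl H K) (fst \o f \o @pair_inr H K)
             (snd \o f \o @pair_inl H K) (snd \o f \o @pair_inr H K).

Section Matrix.
Variables H K : groupType.
Implicit Types (f : hom (H * K)%type (H * K)%type) (M : endo_matrix H K).

Lemma matrix_ofK f : endo_of_matrix (matrix_of f) = f.
Proof.
apply/funext => -[h k]; rewrite [RHS]surjective_pairing /endo_of_matrix /=.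
have -> : (h, k) = pair_inl K h * pair_inr H k.
  by congr (_, _); rewrite ?mulg1 ?mul1g.
by rewrite gmulfM.
Qed.

(** Makes membership independent of the representing matrix: entries are compared only as functions,
    by evaluating [f] on each factor, which avoids equality of records. *)
Lemma matrix_of_endo f M : endo_of_matrix M = f -> calA_matrix H K M ->
  calA_matrix H K (matrix_of f).
Proof.
move=> fE [aA dA bZ cZ].
have aE : mx_alpha (matrix_of f) = mx_alpha M :> (H -> H).
  by apply/funext => h; rewrite /= -fE /= gmulf1 mulg1.
have dE : mx_delta (matrix_of f) = mx_delta M :> (K -> K).
  by apply/funext => k; rewrite /= -fE /= gmulf1 mul1g.
split=> [||k|h].
- by rewrite aE.
- by rewrite dE.
- by rewrite /= -fE /= gmulf1 mul1g.
- by rewrite /= -fE /= gmulf1 mulg1.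
Qed.

Lemma calA_matrix1 : calA_matrix H K (matrix_of idfun).
Proof.
split=> [||k x|h x] /=.
- by split; [exact: hom_morphism | exists idfun].
- by split; [exact: hom_morphism | exists idfun].
- by rewrite /commute mul1g mulg1.
- by rewrite /commute mul1g mulg1.
Qed.

Lemma calA_hom f : calA H K f <-> calA_matrix H K (matrix_of f).
Proof.
split=> [[M MA Mf]|fA]; first exact: (matrix_of_endo Mf MA).
by exists (matrix_of f) => //; exact: matrix_ofK.
Qed.

Lemma endo_of_matrix_morphism M :
  calA_matrix H K M -> monoid_morphism (endo_of_matrix M).
Proof.
move=> [_ _ bZ cZ]; split=> [|x y]; rewrite /endo_of_matrix /=.
  by rewrite !gmulf1 !mulg1.
rewrite !gmulfM; congr (_, _) => /=; rewrite -!mulgA; congr (_ * _).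
  by rewrite !mulgA bZ.
by rewrite !mulgA cZ.
Qed.

Lemma calA_exists_hom (f : H * K -> H * K) : calA H K f ->
  exists2 F : hom (H * K)%type (H * K)%type,
    calA_matrix H K (matrix_of F) & F = f :> (_ -> _).
Proof.
move=> fA; have [F FE] : exists F : hom (H * K)%type _, F = f :> (_ -> _).
  by apply: morphism_hom; case: fA => M /endo_of_matrix_morphism MM <-.
by exists F; rewrite // -calA_hom FE.
Qed.

End Matrix.

Section Entries.
Variables (H K : groupType) (f : hom (H * K)%type (H * K)%type).
Local Notation a := (mx_alpha (matrix_of f)).
Local Notation b := (mx_beta (matrix_of f)).
Local Notation c := (mx_gamma (matrix_of f)).
Local Notation d := (mx_delta (matrix_of f)).

Lemma hom_entries h k : f (h, k) = (a h * b k, c h * d k).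
Proof. by rewrite -[in LHS](matrix_ofK f). Qed.

(** The two factors commute elementwise in the product, and [f] preserves this. *)
Lemma entries_commute_H h k : commute (a h) (b k).
Proof.
have e : pair_inl K h * pair_inr H k = pair_inr H k * pair_inl K h.
  by congr (_, _); rewrite mulg1 mul1g.
by move: (congr1 (fst \o f) e); rewrite !gmulfM.
Qed.

Lemma entries_commute_K h k : commute (d k) (c h).
Proof.
have e : pair_inr H k * pair_inl K h = pair_inl K h * pair_inr H k.
  by congr (_, _); rewrite mulg1 mul1g.
by move: (congr1 (snd \o f) e); rewrite !gmulfM.
Qed.

End Entries.

Section Composition.
Variables (H K : groupType) (f g : hom (H * K)%type (H * K)%type).
Local Notation a := (mx_alpha (matrix_of f)).
Local Notation b := (mx_beta (matrix_of f)).
Local Notation c := (mx_gamma (matrix_of f)).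
Local Notation d := (mx_delta (matrix_of f)).
Local Notation a' := (mx_alpha (matrix_of g)).
Local Notation b' := (mx_beta (matrix_of g)).
Local Notation c' := (mx_gamma (matrix_of g)).
Local Notation d' := (mx_delta (matrix_of g)).

Lemma comp_alpha h : (g (f (h, 1))).1 = a' (a h) * b' (c h).
Proof. by rewrite !hom_entries !gmulf1 !mulg1. Qed.

Lemma comp_beta k : (g (f (1, k))).1 = a' (b k) * b' (d k).
Proof. by rewrite !hom_entries !gmulf1 !mul1g. Qed.

Lemma comp_gamma h : (g (f (h, 1))).2 = c' (a h) * d' (c h).
Proof. by rewrite !hom_entries !gmulf1 !mulg1. Qed.

Lemma comp_delta k : (g (f (1, k))).2 = c' (b k) * d' (d k).
Proof. by rewrite !hom_entries !gmulf1 !mul1g. Qed.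

End Composition.

(* For direct factors X, Y of G embedded by i, j with projections p, q, the   *)
(* endomorphism j \o q is normal, and so is its conjugate g \o j \o q \o f.   *)
Lemma conjugate_projection_normal (G X Y : groupType) (f g : hom G G)
    (i : hom X G) (p : hom G X) (j : hom Y G) (q : hom G Y) :
    cancel f g -> cancel i p -> normal_endo (j \o q) ->
  normal_endo (p \o g \o j \o q \o f \o i).
Proof.
move=> fK iK jqN y x; rewrite /inner_aut /= !(gmulfJ i) !(gmulfJ f).
by have /= -> := jqN (f (i y)) (f (i x)); rewrite /inner_aut !gmulfJ fK iK.
Qed.

Lemma pair_inl_normal (H K : groupType) : normal_endo (@pair_inl H K \o fst).
Proof. by move=> y x; congr (_, _); rewrite /= mul1g mulVg. Qed.

Lemma pair_inr_normal (H K : groupType) : normal_endo (@pair_inr H K \o snd).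
Proof. by move=> y x; congr (_, _); rewrite /= mul1g mulVg. Qed.

(** * Matrices of automorphisms *)

Section Automorphism.
Variables H K : groupType.
Hypothesis inc : incompatible H K.
Implicit Types f g : hom (H * K)%type (H * K)%type.

Lemma beta_gamma_fixed f g h : cancel f g -> cancel g f ->
  mx_beta (matrix_of g) (mx_gamma (matrix_of f) h) = h -> h = 1.
Proof.
move=> fK gK; apply: (incompatible_sym inc).
- exact: (conjugate_projection_normal (p := fst) fK _ (@pair_inr_normal H K)).
- exact: (conjugate_projection_normal (p := snd) gK _ (@pair_inl_normal H K)).
Qed.

Lemma gamma_beta_fixed f g k : cancel f g -> cancel g f ->
  mx_gamma (matrix_of f) (mx_beta (matrix_of g) k) = k -> k = 1.
Proof.
move=> fK gK; apply: inc.
- exact: (conjugate_projection_normal (p := snd) gK _ (@pair_inl_normal H K)).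
- exact: (conjugate_projection_normal (p := fst) fK _ (@pair_inr_normal H K)).
Qed.

Lemma alpha_alpha_bij f g : min_normal H -> cancel f g -> cancel g f ->
  bijective (mx_alpha (matrix_of g) \o mx_alpha (matrix_of f)).
Proof.
move=> minH fK gK.
have aa_inj : injective (mx_alpha (matrix_of g) \o mx_alpha (matrix_of f)).
  (* The upper left entry of gf = 1 reads alpha' alpha + beta' gamma = 1, so beta' gamma fixes the
     kernel of alpha' alpha. *)
  apply: gmulf_inj => h aa1; apply: (beta_gamma_fixed fK gK).
  by rewrite -[LHS]mul1g -aa1 /comp -comp_alpha fK.
apply: inj_surj_bij => //; apply: min_normal_surj => //.
exact: (conjugate_projection_normal (p := fst) fK _ (@pair_inl_normal H K)).
Qed.

Lemma delta_delta_bij f g : min_normal K -> cancel f g -> cancel g f ->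
  bijective (mx_delta (matrix_of g) \o mx_delta (matrix_of f)).
Proof.
move=> minK fK gK.
have dd_inj : injective (mx_delta (matrix_of g) \o mx_delta (matrix_of f)).
  apply: gmulf_inj => k dd1; apply: (gamma_beta_fixed gK fK).
  by rewrite -[LHS]mulg1 -dd1 /comp -comp_delta fK.
apply: inj_surj_bij => //; apply: min_normal_surj => //.
exact: (conjugate_projection_normal (p := snd) fK _ (@pair_inr_normal H K)).
Qed.

Lemma Aut_calA_matrix f : min_normal H -> min_normal K -> bijective f ->
  calA_matrix H K (matrix_of f).
Proof.
move=> minH minK f_bij.
have [g fK gK] := Aut_hom_inverse (conj (hom_morphism f) f_bij).
have a_bij : bijective (mx_alpha (matrix_of f)).
  by apply: comp_bij_bij (alpha_alpha_bij _ gK fK) (alpha_alpha_bij _ fK gK).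
have d_bij : bijective (mx_delta (matrix_of f)).
  by apply: comp_bij_bij (delta_delta_bij _ gK fK) (delta_delta_bij _ fK gK).
split=> [||k y|h y].
- by split=> //; exact: hom_morphism.
- by split=> //; exact: hom_morphism.
- by have [h <-] := bij_surj y a_bij; apply/commute_sym/entries_commute_H.
- by have [k <-] := bij_surj y d_bij; apply/commute_sym/entries_commute_K.
Qed.

End Automorphism.

(** * The subgroup property *)

Section CalA.
Variables H K : groupType.
Hypotheses (inc : incompatible H K) (minHK : min_normal H \/ min_normal K).
Implicit Types f g : hom (H * K)%type (H * K)%type.

Lemma minKH : min_normal K \/ min_normal H.
Proof. by case: minHK; [right|left]. Qed.

Lemma calA_bij f : calA_matrix H K (matrix_of f) -> bijective f.
Proof.
move=> [aA dA bZ cZ].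
have [d' dK d'K] := Aut_hom_inverse dA.
have [b' b'E] := central_hom_inv bZ.
pose a := mx_alpha (matrix_of f); pose b := mx_beta (matrix_of f).
pose c := mx_gamma (matrix_of f).
pose c' : hom H K := d' \o c.
(* the Schur complement a - b d^-1 c *)
have s_bij : bijective (fun h => a h * b' (c' h)).
  apply: add_central_bij => //; first by case: aA.
    by move=> k; rewrite b'E; exact: centerV.
  move=> h; apply: (center_surj (f := d')) => // k.
  by exists (mx_delta (matrix_of f) k).
(* On the kernel, the second coordinate determines [k] from [h]; substituting it into the first puts
   [h] in the kernel of the Schur complement. *)
apply: inj_surj_bij; first apply: gmulf_inj => -[h k].
  rewrite hom_entries => -[hk1 hk2].
  have kE : k = (c' h)^-1.
    by rewrite /c' /= -gmulfV (mulg1_eq hk2) dK.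
  have h1 : h = 1.
    apply: (bij_inj s_bij); rewrite !gmulf1 mulg1 b'E.
    by rewrite -gmulfV -kE.
  by rewrite kE h1 gmulf1 invg1.
(* Block elimination: the second coordinate forces k = d'((c h)^-1 y), which turns the first into
   the equation solved here for [h]. *)
move=> [x y]; have [h hE] := bij_surj (x * (b (d' y))^-1) s_bij.
exists (h, d' ((c h)^-1 * y)); rewrite hom_entries d'K mulVKg; congr (_, _).
rewrite !gmulfM mulgA [d' _]gmulfV gmulfV.
by move: hE; rewrite b'E => ->; rewrite mulgVK.
Qed.

(** The diagonal entries of the product are central perturbations of automorphisms; the off-diagonal
    ones are central because surjective homomorphisms preserve centers. *)
Lemma calA_comp f g : calA_matrix H K (matrix_of f) ->
  calA_matrix H K (matrix_of g) -> calA_matrix H K (matrix_of (g \o f)).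
Proof.
move=> [[_ aA] [_ dA] bZ cZ] [[_ a'A] [_ d'A] b'Z c'Z].
split=> [||k|h].
- split; first exact: hom_morphism.
  have := add_central_bij
    (a := mx_alpha (matrix_of g) \o mx_alpha (matrix_of f))
    inc minHK (bij_comp a'A aA) b'Z cZ.
  by move=> /eq_bij; apply=> h; rewrite -comp_alpha.
- split; first exact: hom_morphism.
  have := add_central_bij
    (a := mx_delta (matrix_of g) \o mx_delta (matrix_of f))
    (incompatible_sym inc) minKH (bij_comp d'A dA) c'Z bZ.
  by move=> /eq_bij; apply=> k; rewrite -c'Z -comp_delta.
- rewrite /= comp_beta; apply: centerM => //.
  by apply: center_surj => // h; exact: bij_surj.
- rewrite /= comp_gamma; apply: centerM => //.
  by apply: center_surj => // k; exact: bij_surj.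
Qed.

Lemma calA_inverse f g : calA_matrix H K (matrix_of f) ->
  cancel f g -> cancel g f -> calA_matrix H K (matrix_of g).
Proof.
move=> [aA dA bZ cZ] fK gK.
have [ai aK aiK] := Aut_hom_inverse aA.
have [di dK diK] := Aut_hom_inverse dA.
(* The upper right entry of fg = 1 gives alpha beta' = -(beta delta'), which is central; then apply
   alpha^-1. *)
have b'Z k : center H (mx_beta (matrix_of g) k).
  rewrite -[mx_beta _ k]aK; apply: center_surj => [h|].
    by exists (mx_alpha (matrix_of f) h).
  have := congr1 fst (gK (1, k)); rewrite comp_beta => /mulg1_eq bE.
  by rewrite -[_ (mx_beta _ k)]invgK bE; apply: centerV.
have c'Z h : center K (mx_gamma (matrix_of g) h).
  rewrite -[mx_gamma _ h]dK; apply: center_surj => [k|].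
    by exists (mx_delta (matrix_of f) k).
  have := congr1 snd (gK (h, 1)); rewrite comp_gamma => /mulg1_eq <-.
  exact: centerV.
split=> //; (split; first exact: hom_morphism).
(* From gf = 1, alpha' = (1 - beta' gamma) alpha^-1, a composite of bijections. *)
- have [bV bVE] := central_hom_inv b'Z.
  have bVZ k : center H (bV k) by rewrite bVE; apply: centerV.
  have s_bij := add_central_bij (a := idfun) inc minHK
    (Bijective (frefl _) (frefl _)) bVZ cZ.
  have ai_bij : bijective ai by exists (mx_alpha (matrix_of f)).
  apply: (eq_bij (bij_comp s_bij ai_bij)) => x.
  rewrite /comp bVE -[x in RHS]aiK.
  apply: (mulIg (mx_beta (matrix_of g) (mx_gamma (matrix_of f) (ai x)))).
  by rewrite -[RHS]comp_alpha fK mulgVK.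
- have [cV cVE] := central_hom_inv c'Z.
  have cVZ h : center K (cV h) by rewrite cVE; apply: centerV.
  have s_bij := add_central_bij (a := idfun) (incompatible_sym inc) minKH
    (Bijective (frefl _) (frefl _)) cVZ bZ.
  have di_bij : bijective di by exists (mx_delta (matrix_of f)).
  apply: (eq_bij (bij_comp s_bij di_bij)) => x.
  rewrite /comp cVE -[x in RHS]diK.
  apply: (mulIg (mx_gamma (matrix_of g) (mx_beta (matrix_of f) (di x)))).
  by rewrite mulgVK -[RHS]c'Z -[RHS]comp_delta fK.
Qed.

End CalA.

Theorem theorem4p2 (H K : groupType) (inc : incompatible H K) :
  (min_normal H \/ min_normal K -> subgroup_of_Aut (calA H K)) /\
  (min_normal H /\ min_normal K -> Aut (H * K)%type = calA H K).
Proof.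
have calA_Aut : min_normal H \/ min_normal K -> calA H K `<=` Aut (H * K)%type.
  move=> minHK f /calA_exists_hom[F FA <-].
  by split; [exact: hom_morphism | exact: calA_bij FA].
split=> [minHK|[minH minK]].
  split=> [|||f g /calA_exists_hom[F FA <-] FK gK].
  - exact: calA_Aut.
  - exact/(calA_hom idfun)/calA_matrix1.
  - move=> f g /calA_exists_hom[F FA <-] /calA_exists_hom[G GA <-].
    by apply/(calA_hom (F \o G))/calA_comp.
  (* The inverse is given as a bare function and must first be made a homomorphism to have a
     matrix. *)
  - have [|gM _] := Aut_inverse _ FK gK.
      by split; [exact: hom_morphism | exists g].
    have [G GE] := morphism_hom gM; rewrite -GE in FK gK *.
    exact/calA_hom/(calA_inverse inc minHK FA).
apply/seteqP; split=> [f [/morphism_hom[F <-] F_bij]|].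
  by apply/calA_hom/Aut_calA_matrix.
by apply: calA_Aut; left.
Qed.
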